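(* Let $G$ be an abelian group with a translation invariant metric $d$ such that $(G,d)$ is separable and complete, and let $\Lambda\ne\emptyset$ be an index set. Assume: (A1) for each $\lambda\in\Lambda$, $A_\lambda:D(A_\lambda)\subset\mathrm{BUC}(G)\to\mathrm{BUC}(G)$ is the generator of a Markovian convolution semigroup $(S_\lambda(t))_{t\ge0}$ of linear operators on $\mathrm{BUC}(G)$; (A2) the subspace $D:=\{f\in\bigcap_{\lambda\in\Lambda}D(A_\lambda):\{A_\lambda f:\lambda\in\Lambda\}\text{ is bounded and uniformly equicontinuous}\}$ is dense in $\mathrm{BUC}(G)$; (A3) for every $\varepsilon>0$ there exists $\varphi\in\bigcap_{\lambda\in\Lambda}(D(A_\lambda)\cap C_0(G))$ with $0\le\varphi\le1$, $\varphi(0)=1$ and $\sup_{\lambda\in\Lambda}\|A_\lambda\varphi\|_\infty\le\varepsilon$. Let $(\mathcal S(t))_{t\ge0}$ be the sublinear Markovian convolution semigroup associated with $(A_\lambda)_{\lambda\in\Lambda}$, i.e. $(\mathcal S(t)f)(x):=\sup_{\pi\in P_t}(J_\pi f)(x)$ (defined in the context), which is represented as $(\mathcal S(t)f)(x)=\mathcal E(f(x+X_t))$ by an $\mathcal E$-Lévy process $(X_t)_{t\ge 0}$. Then $(\mathcal S(t))_{t\ge0}$ is continuous from above on $\mathrm{BUC}(G)$: for every $t\ge0$ and every decreasing sequence $(f_n)$ in $\mathrm{BUC}(G)$ converging pointwise to some $f\in\mathrm{BUC}(G)$, one has $\mathcal S(t)f_n\searrow\mathcal S(t)f$ pointwi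se.
   Context: $\mathrm{BUC}(G)$ is the space of bounded uniformly continuous functions $G\to\mathbb R$, with supremum norm $\|\cdot\|_\infty$; $C_0(G)$ is the closure with respect to $\|\cdot\|_\infty$ of the space of continuous functions with compact support. Inequalities, suprema and monotone limits of functions are pointwise. A convex expectation on a convex set $M$ of real functions containing the constants is a map $\mathcal E:M\to\mathbb R$ which is monotone, satisfies $\mathcal E(\alpha)=\alpha$ for constants $\alpha$, and is convex; it is sublinear if also $\mathcal E(\lambda X)=\lambda\mathcal E(X)$ for $\lambda>0$. A convex (sublinear) Markovian convolution is a map $\mathcal S:\mathrm{BUC}(G)\to\mathrm{BUC}(G)$ such that $f\mapsto(\mathcal Sf)(x)$ is a convex (sublinear) expectation on $\mathrm{BUC}(G)$ for every $x\in G$; $\mathcal Sf_n\nearrow\mathcal Sf$ for every increasing sequence $(f_n)$ in $\mathrm{BUC}(G)$ converging pointwise to $f\in\mathrm{BUC}(G)$; and $(\mathcal Sf)(x)=(\mathcal Sf_x)(0)$, where $f_x(y):=f(x+y)$. A Markovian convolution semigroup on $\mathrm{BUC}(G)$ is a family $(\mathcal S(t))_{t\ge0}$ of Markovian convolutions with $\mathcal S(0)f=f$, $\mathcal S(s+t)=\mathcal S(s)\mathcal S(t)$ and $\lim_{t\searrow0}\|\mathcal S(t)f-f\|_\infty=0$ for all $f\in\mathrm{BUC}(G)$; it is ''of linear operators'' if each $\mathcal S(t)$ is linear. The generator in the linear case is the usual generator of a strongly continuous semigroup. A sublinear expectation space $(\Omega,\mathcal F,\mathcal E)$ is a measurable space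 with a sublinear expectation $\mathcal E$ on the bounded measurable functions which is continuous along pointwise convergent increasing sequences of bounded measurable functions with bounded limit. A $G$-valued $\mathcal E$-Lévy process is a family of measurable maps $X_t:\Omega\to G$ with $\mathcal E(f(X_0))=f(0)$; $\mathcal E(f(X_{s+t}-X_s))=\mathcal E(f(X_t))$; $X_{s+t}-X_s$ independent of $(X_{t_1},\dots,X_{t_n})$ for $0\le t_1<\dots<t_n\le s$; and $\mathcal E(f(X_t))\to f(0)$ as $t\searrow0$, for all bounded continuous $f:G\to\mathbb R$. Here $X$ is independent of $Y:\Omega\to S$ ($S$ Polish) if $\mathcal E(f(Y,X))=\mathcal E(\mathcal E(f(y,X))|_{y=Y})$ for all bounded continuous $f$ on $S\times G$. Construction of $\mathcal S$: for $f\in\mathrm{BUC}(G)$ and $t\ge0$ let $(J_tf)(x):=\sup_{\lambda\in\Lambda}(S_\lambda(t)f)(x)$, $x\in G$ (again an element of $\mathrm{BUC}(G)$). Let $P_t$ be the set of finite sets $\pi\subset[0,\infty)$ with $0\in\pi$ and $\max\pi=t$. For $\pi=\{t_0,\dots,t_m\}$ with $0=t_0<t_1<\dots<t_m$ put $J_\pi f:=J_{t_1-t_0}\cdots J_{t_m-t_{m-1}}f$, and $J_{\{0\}}f:=f$. Then $(\mathcal S(t)f)(x):=\sup_{\pi\in P_t}(J_\pi f)(x)$. *)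

(* Defs.v *)
From HB Require Import structures.
From mathcomp Require Import all_boot all_order all_algebra finmap.
From mathcomp Require Import all_classical all_reals all_analysis.

Set Implicit Arguments.
Unset Strict Implicit.
Unset Printing Implicit Defensive.

Import Order.TTheory GRing.Theory Num.Theory.
Import numFieldNormedType.Exports.

Local Open Scope classical_set_scope.
Local Open Scope ring_scope.

(* The abelian group carries a uniform structure (hence a topology), which the
   last clause requires to be the one induced by the metric [d]; with it,
   continuity, uniform continuity and completeness are those of [(G, d)]. *)
Definition invariant_metric (R : realType) (G : PreUniformZmodule.type)
    (d : G -> G -> R) : Prop :=
  [/\ forall x y, d x y = 0 <-> x = y,
      forall x y, d x y = d y x,
      forall x y z, d x z <= d x y + d y z,
      forall x y z, d (x + z) (y + z) = d x y &
      entourage = entourage_ (fun (x : G) (e : R) => [set y | d x y < e])].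

Definition complete (T : uniformType) : Prop :=
  forall F : set_system T, ProperFilter F -> cauchy F ->
    exists x : T, F --> x.

Definition separable (T : topologicalType) : Prop :=
  exists D : set T, countable D /\ dense D.

(* Valued in [\bar R], so that it is [+oo] on unbounded functions. *)
Definition supnorm (R : realType) (T : Type) (f : T -> R) : \bar R :=
  ereal_sup (range (fun x => (`|f x|)%:E)).

Definition increases_to (R : realType) (T : Type)
    (u : nat -> T -> R) (f : T -> R) : Prop :=
  (forall x, nondecreasing_seq (u ^~ x)) /\
  (forall x, u ^~ x @ \oo --> f x).

Definition decreases_to (R : realType) (T : Type)
    (u : nat -> T -> R) (f : T -> R) : Prop :=
  (forall x, nonincreasing_seq (u ^~ x)) /\
  (forall x, u ^~ x @ \oo --> f x).

(* A functional or operator defined on a set of functions is encoded as a total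
   map; its values outside of that set are never constrained nor used. *)
Definition convex_expectation (R : realType) (T : Type) (M : set (T -> R))
    (E : (T -> R) -> R) : Prop :=
  [/\ forall f g, M f -> M g -> (forall x, f x <= g x) -> E f <= E g,
      forall a : R, E (cst a) = a &
      forall (a : R) f g, 0 <= a <= 1 -> M f -> M g ->
        E (fun x => a * f x + (1 - a) * g x) <= a * E f + (1 - a) * E g].

Definition sublinear_expectation (R : realType) (T : Type) (M : set (T -> R))
    (E : (T -> R) -> R) : Prop :=
  convex_expectation M E /\
  forall (a : R) f, 0 < a -> M f -> E (fun x => a * f x) = a * E f.

Section function_spaces.
Context {R : realType} {G : PreUniformZmodule.type}.
Implicit Types f g : G -> R.

Definition BUC : set (G -> R) :=
  [set f | bounded_fun f /\ unif_continuous f].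

Definition Cc : set (G -> R) :=
  [set f | continuous f /\ compact (closure [set x | f x != 0])].

Definition C0 : set (G -> R) :=
  [set f | forall e : R, 0 < e ->
    exists2 g, Cc g & (supnorm (f \- g)%R < e%:E)%E].

Definition shift f (x : G) : G -> R := fun y => f (x + y).

Definition markovian_convolution (T : (G -> R) -> (G -> R)) : Prop :=
  [/\ forall f, BUC f -> BUC (T f),
      forall x, convex_expectation BUC (fun f => T f x),
      forall (u : nat -> G -> R) f, (forall n, BUC (u n)) -> BUC f ->
        increases_to u f -> increases_to (fun n => T (u n)) (T f) &
      forall f x, BUC f -> T f x = T (shift f x) 0].

Definition markovian_convolution_semigroup
    (S : R -> (G -> R) -> (G -> R)) : Prop :=
  [/\ forall t, 0 <= t -> markovian_convolution (S t),
      forall f, BUC f -> S 0 f = f,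
      forall s t f, 0 <= s -> 0 <= t -> BUC f -> S (s + t) f = S s (S t f) &
      forall f, BUC f ->
        supnorm (S t f \- f) @[t --> (0 : R)^'+] --> 0%E].

Definition linear_on_BUC (T : (G -> R) -> (G -> R)) : Prop :=
  forall (a : R) f g, BUC f -> BUC g ->
    T (fun x => a * f x + g x) = (fun x => a * T f x + T g x).

Definition generator_at (S : R -> (G -> R) -> (G -> R)) f g : Prop :=
  supnorm (fun x => t^-1 * (S t f x - f x) - g x)
    @[t --> (0 : R)^'+] --> 0%E.

Definition is_generator (S : R -> (G -> R) -> (G -> R))
    (DA : set (G -> R)) (A : (G -> R) -> (G -> R)) : Prop :=
  (forall f, DA f <-> BUC f /\ exists2 g, BUC g & generator_at S f g) /\
  (forall f, DA f -> BUC (A f) /\ generator_at S f (A f)).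

Definition uniformly_bounded (L : Type) (F : L -> G -> R) : Prop :=
  (ereal_sup (range (fun l => supnorm (F l))) < +oo)%E.

Definition uniformly_equicontinuous (L : Type) (F : L -> G -> R) : Prop :=
  forall e : R, 0 < e -> exists2 U, entourage U &
    forall l x y, U (x, y) -> `|F l x - F l y| < e.

Definition common_domain (L : Type) (DA : L -> set (G -> R))
    (A : L -> (G -> R) -> (G -> R)) : set (G -> R) :=
  [set f | [/\ forall l, DA l f, uniformly_bounded (fun l => A l f) &
               uniformly_equicontinuous (fun l => A l f)]].

Definition dense_in_BUC (D : set (G -> R)) : Prop :=
  forall f, BUC f -> forall e : R, 0 < e ->
    exists2 g, D g & (supnorm (f \- g)%R < e%:E)%E.

Definition continuous_from_above (T : (G -> R) -> (G -> R)) : Prop :=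
  forall (u : nat -> G -> R) f, (forall n, BUC (u n)) -> BUC f ->
    decreases_to u f -> decreases_to (fun n => T (u n)) (T f).

End function_spaces.

Section associated_semigroup.
Context {R : realType} {G : PreUniformZmodule.type} {L : Type}.
Variable S : L -> R -> (G -> R) -> (G -> R).
Implicit Type f : G -> R.

Definition Jop (t : R) f : G -> R :=
  fun x => sup (range (fun l => S l t f x)).

Fixpoint Jsteps (t0 : R) (ts : seq R) f : G -> R :=
  if ts is t1 :: ts' then Jop (t1 - t0) (Jsteps t1 ts' f) else f.

Definition Jpart (p : {fset R}) f : G -> R :=
  let ts := sort <=%R (enum_fset p) in Jsteps (head 0 ts) (behead ts) f.

Definition partitions (t : R) : set {fset R} :=
  [set p : {fset R} | [/\ 0 \in p, t \in p &
    forall s, s \in p -> 0 <= s <= t]].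

Definition assoc_semigroup (t : R) f : G -> R :=
  fun x => sup [set Jpart p f x | p in partitions t].

End associated_semigroup.

Section levy_processes.
Context {R : realType} {d : measure_display} {Omega : measurableType d}.
Variable E : (Omega -> R) -> R.

Definition bounded_measurable : set (Omega -> R) :=
  [set f : Omega -> R | measurable_fun setT f /\ bounded_fun f].

Definition sublinear_expectation_space : Prop :=
  sublinear_expectation bounded_measurable E /\
  forall (u : nat -> Omega -> R) f,
    (forall n, bounded_measurable (u n)) -> bounded_fun f ->
    increases_to u f -> E (u n) @[n --> \oo] --> E f.

(* Meant for Polish [S]. *)
Definition independent_of {G S : topologicalType}
    (X : Omega -> G) (Y : Omega -> S) : Prop :=
  forall f : S * G -> R, continuous f -> bounded_fun f ->
    E (fun w => f (Y w, X w)) = E (fun w => E (fun w' => f (Y w, X w'))).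

Definition borel_measurable {G : topologicalType} (X : Omega -> G) : Prop :=
  forall B : set G, <<s @open G >> B -> measurable (X @^-1` B).

Definition levy_process {G : PreUniformZmodule.type}
    (X : R -> Omega -> G) : Prop :=
  (forall t, 0 <= t -> borel_measurable (X t)) /\
  [/\ forall f : G -> R, continuous f -> bounded_fun f ->
        E (fun w => f (X 0 w)) = f 0,
      forall (s t : R) (f : G -> R), 0 <= s -> 0 <= t ->
        continuous f -> bounded_fun f ->
        E (fun w => f (X (s + t) w - X s w)) = E (fun w => f (X t w)),
      forall (s t : R) (n : nat) (ts : 'I_n -> R), 0 <= s -> 0 <= t ->
        (forall i, 0 <= ts i <= s) ->
        {homo ts : i j / (i < j)%N >-> i < j} ->
        independent_of (fun w => X (s + t) w - X s w)
          (fun w => \row_(i < n) X (ts i) w) &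
      forall f : G -> R, continuous f -> bounded_fun f ->
        E (fun w => f (X t w)) @[t --> (0 : R)^'+] --> f 0].

End levy_processes.

(* Main.v *)
Require Import Defs.
From HB Require Import structures.
From mathcomp Require Import all_boot all_order all_algebra finmap.
From mathcomp Require Import all_classical all_reals all_analysis.
From mathcomp Require Import ring lra.
Set Implicit Arguments.
Unset Strict Implicit.
Unset Printing Implicit Defensive.
Import Order.TTheory GRing.Theory Num.Theory.
Import numFieldNormedType.Exports.
Local Open Scope classical_set_scope.
Local Open Scope ring_scope.

(** For [f_n] decreasing to [f] and [0 <= f_0 - f <= M], take [phi] as in (A3)
    with small [eps] and put [h := e/2 + M (1 - phi (. - x0))].  Since [phi] is
    in [C0], Dini's theorem gives [f_n <= f + h] for large [n].  As
    [A_l phi >= - eps], every [S_l] satisfies [S_l(s) h <= h + M eps s], and this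
    is stable under suprema over [l] and compositions, so
    [J_pi f_n <= J_pi f + h + M eps t] for all partitions [pi] of [0, t].
    At [x0], where [h = e/2], this is the required estimate. *)

(** * Suprema and Dini's theorem *)

Lemma supnorm_ge (R : realType) (T : Type) (f : T -> R) x :
  ((`|f x|)%:E <= supnorm f)%E.
Proof. by apply: ereal_sup_ubound; exists x. Qed.

Lemma supnorm_lt (R : realType) (T : Type) (f : T -> R) (e : R) x :
  (supnorm f < e%:E)%E -> `|f x| < e.
Proof. by rewrite -lte_fin; apply: le_lt_trans; exact: supnorm_ge. Qed.

(** Carries estimates that hold for each [S l] over to [Jop]. The bound on [v] makes its [sup] a
    genuine supremum, and [u] inherits a bound from it. *)
Lemma sup_range_leD (R : realType) (L : Type) (u v : L -> R) (e : R) :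
  inhabited L -> has_ubound (range v) -> (forall l, u l <= v l + e) ->
  sup (range u) <= sup (range v) + e.
Proof.
move=> [l0] vub uv; apply: ge_sup; first by exists (u l0), l0.
move=> _ [l _ <-]; apply: (le_trans (uv l)).
by rewrite lerD2r ub_le_sup//; exists l.
Qed.

(** Near each [x] some [u n] stays below [e] by continuity, and all later terms do by monotonicity.
    Compactness, in its near-covering form, makes the index uniform. *)
Lemma dini (R : realType) (T : topologicalType) (K : set T) (u : nat -> T -> R)
    (e : R) :
  compact K -> (forall n, continuous (u n)) ->
  decreases_to u (fun=> 0) -> 0 < e ->
  \forall n \near \oo, forall x, K x -> u n x < e.
Proof.
move=> /compact_near_coveringP Kc uc [und u0] e0.
have H : forall x, K x -> \forall x' \near x & n \near \oo, u n x' < e.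
  move=> x _; have /cvgr_lt/(_ e e0) [n _ un] := u0 x.
  have unx := un n (leqnn n).
  exists ([set x' | u n x' < e], [set m | (n <= m)%N]) => /=.
    by split; [exact: (cvgr_lt _ (uc n x) e unx)|exists n].
  by move=> [x' m] /= [ux' nm]; apply: le_lt_trans ux'; exact: und.
exact: (Kc nat \oo (fun n x => u n x < e) _ H).
Qed.

(** * The space BUC in terms of the metric *)

Section bounded_uniformly_continuous.
Context {R : realType} {G : PreUniformZmodule.type} (d : G -> G -> R).
Hypothesis d_inv : invariant_metric d.
Implicit Types f g : G -> R.

Lemma bounded_funE f : bounded_fun f <-> exists M : R, forall x, `|f x| <= M.
Proof.
have PF : ProperFilter (globally [set: G]) := globally_properfilter (a := 0) I.
split=> [/ex_bound[M fM]|[M fM]]; first by exists M => x; exact: fM.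
by apply/ex_bound; exists M => x _; exact: fM.
Qed.

Lemma BUCP f : BUC f <->
  (exists M : R, forall x, `|f x| <= M) /\
  (forall e : R, 0 < e -> exists2 r : R, 0 < r &
     forall x y, d x y < r -> `|f x - f y| < e).
Proof.
have [_ _ _ _ entE] := d_inv; split.
- move=> [/bounded_funE fM fu]; split=> //.
  move=> e e0; have /fu : entourage [set xy : R * R | ball xy.1 e xy.2].
    by rewrite -entourage_ballE; exists e.
  rewrite /nbhs/= entE => -[r r0 H]; exists r => // x y xy.
  exact: (H (x, y)).
- move=> [fM fu]; split; first exact/bounded_funE.
  move=> U; rewrite /nbhs/= -entourage_ballE => -[e e0 eU].
  have [r r0 H] := fu _ e0; rewrite entE; exists r => // -[x y] /= xy.
  by apply: eU => /=; exact: H.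
Qed.

Lemma BUC_continuous f : BUC f -> continuous f.
Proof.
move=> [_ fu] x; apply/cvg_entourageP => U /fu entU.
rewrite near_simpl; near=> y.
have : xsection [set xy | U (f xy.1, f xy.2)] x y.
  by near: y; exact: (@nbhs_entourage G x _ entU).
by rewrite /xsection/= inE.
Unshelve. all: by end_near. Qed.

Lemma BUC_cst (a : R) : BUC (cst a : G -> R).
Proof.
apply/BUCP; split; first by exists `|a|.
by move=> e e0; exists 1 => // x y _; rewrite subrr normr0.
Qed.

(* Unqualified, [shift] would denote MathComp-Analysis' translation. *)
Lemma BUC_shift f x : BUC f -> BUC (Defs.shift f x).
Proof.
have [_ _ _ dD _] := d_inv.
move=> /BUCP[[M fM] fu]; apply/BUCP; split.
  by exists M => y; exact: (fM (x + y)).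
move=> e /fu[r r0 H]; exists r => // y z yz.
by apply: H; rewrite ![x + _]addrC dD.
Qed.

Lemma BUC_linear (a : R) f g : BUC f -> BUC g -> BUC (fun x => a * f x + g x).
Proof.
move=> /BUCP[[M fM] fu] /BUCP[[N gN] gu]; apply/BUCP; split.
  exists (`|a| * M + N) => x; apply: (le_trans (ler_normD _ _)).
  by rewrite lerD// normrM ler_wpM2l.
(* Dividing by [|a| + 1] instead of [|a|] covers [a = 0]. *)
move=> e e0; have a0 : 0 < `|a| + 1 by rewrite ltr_wpDl.
have [|r r0 fr] := fu (e / 2 / (`|a| + 1)); first by rewrite !divr_gt0.
have [|s s0 gs] := gu (e / 2); first by rewrite divr_gt0.
exists (Num.min r s); first by rewrite lt_min r0.
move=> x y; rewrite lt_min => /andP[/fr + /gs].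
rewrite ltr_pdivlMr// => fxy gxy.
have -> : a * f x + g x - (a * f y + g y) = a * (f x - f y) + (g x - g y).
  by ring.
apply: (le_lt_trans (ler_normD _ _)); rewrite normrM.
have : `|a| * `|f x - f y| <= `|f x - f y| * (`|a| + 1).
  by rewrite mulrC ler_wpM2l// lerDl.
lra.
Qed.

End bounded_uniformly_continuous.

(** * Order and translation estimates for linear Markovian convolutions *)

Section linear_markovian_convolutions.
Context {R : realType} {G : PreUniformZmodule.type} (d : G -> G -> R).
Hypothesis d_inv : invariant_metric d.
Variable T : (G -> R) -> (G -> R).
Hypotheses (T_markov : markovian_convolution T) (T_lin : linear_on_BUC T).
Implicit Types f g : G -> R.

Lemma markov_cst (a : R) x : T (cst a) x = a.
Proof. by have [_ /(_ x)[]] := T_markov. Qed.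

(** By linearity and preservation of constants, [T] sends [g + e] to [T g + e]; monotonicity does
    the rest. *)
Lemma markov_leD f g (e : R) x : BUC f -> BUC g ->
  (forall y, f y <= g y + e) -> T f x <= T g x + e.
Proof.
move=> bf bg fg; have be : BUC (cst e) := BUC_cst d_inv e.
have [_ /(_ x)[mono _ _] _ _] := T_markov.
have -> : T g x + e = T (fun y => 1 * g y + cst e y) x.
  by rewrite T_lin// mul1r markov_cst.
by apply: mono => //[|y]; [exact: (BUC_linear d_inv)|rewrite mul1r].
Qed.

Lemma markov_shift f x y : BUC f -> T (Defs.shift f x) y = T f (x + y).
Proof.
have [_ _ _ Ts] := T_markov; move=> bf.
rewrite Ts; last exact: (BUC_shift d_inv).
rewrite [RHS]Ts//; congr (T _ 0); apply/funext => z.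
by rewrite /Defs.shift addrA.
Qed.

(** Because [T] commutes with translations, [T f] inherits the modulus of continuity of [f], with no
    dependence on [T]. *)
Lemma markov_shift_le f (e : R) x y : BUC f ->
  (forall z, f (x + z) <= f (y + z) + e) -> T f x <= T f y + e.
Proof.
move=> bf fxy; rewrite -[x]addr0 -[y]addr0 -!markov_shift//.
by apply: markov_leD => //; exact: (BUC_shift d_inv).
Qed.

Lemma markov_le_cst f (M : R) x : BUC f -> (forall y, f y <= M) -> T f x <= M.
Proof.
move=> bf fM; rewrite -[M]add0r -[X in X + _](markov_cst 0 x).
by apply: markov_leD => // [|y]; [exact: (BUC_cst d_inv)|rewrite add0r].
Qed.

Lemma markov_ge_cst f (M : R) x : BUC f -> (forall y, M <= f y) -> M <= T f x.
Proof.
move=> bf fM; rewrite -[M](markov_cst M x) -[leRHS]addr0.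
by apply: markov_leD => // [|y]; [exact: (BUC_cst d_inv)|rewrite addr0].
Qed.

End linear_markovian_convolutions.

(** * From the generator to a lower bound on the semigroup *)

Section generator_lower_bound.
Context {R : realType} {G : PreUniformZmodule.type} (d : G -> G -> R).
Hypothesis d_inv : invariant_metric d.
Variable S : R -> (G -> R) -> (G -> R).
Hypotheses (S_markov : markovian_convolution_semigroup S)
  (S_lin : forall t, 0 <= t -> linear_on_BUC (S t)).

(* The infinitesimal bound extends to [s > 0] by chopping [0, s] into small
   steps, which avoids integrating [S r g] over [r]. *)
Lemma semigroup_ge (f g : G -> R) (c s : R) x :
  BUC f -> generator_at S f g -> (forall y, - c <= g y) -> 0 <= s ->
  f x - c * s <= S s f x.
Proof.
move=> bf fg gc s0; have [Smc S0 SD _] := S_markov.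
(* [q] is the error allowed per unit of time; over [[0, s]] it adds up to [q * s <= e]. *)
apply/ler_addgt0Pr => e e0; pose q := e / (s + 1).
have s1 : 0 < s + 1 by rewrite ltr_wpDl.
have q0 : 0 < q by rewrite divr_gt0.
(* For small [t] the difference quotient is within [q] of [g >= - c], uniformly in [y]. *)
have [r r0 fr] : exists2 r, 0 < r &
    forall t y, 0 < t < r -> f y <= S t f y + (c + q) * t.
  have /fg [r /= r0 H] : nbhs 0%E [set y : \bar R | (y < q%:E)%E].
    by apply: open_nbhs_nbhs; split; [exact: open_ereal_lt_ereal|rewrite /= lte_fin].
  exists r => // t y /andP[t0 tr].
  have := H t; rewrite /ball_/= sub0r normrN gtr0_norm// => /(_ tr t0).
  move=> /(supnorm_lt y); rewrite ltr_norml => /andP[+ _].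
  rewrite ltrBrDr => tq; have : - (c + q) <= t^-1 * (S t f y - f y).
    by apply/ltW/(le_lt_trans _ tq); have := gc y; lra.
  rewrite mulrC ler_pdivlMr//; lra.
(* The successor keeps [n] positive even if the Archimedean bound is 0. *)
pose n := (Num.bound (s / r)).+1.
have n0 : 0 < n%:R :> R by rewrite ltr0n.
have sn : s / n%:R < r.
  rewrite ltr_pdivrMr// mulrC -ltr_pdivrMr//.
  apply: (lt_le_trans (archi_boundP _)); first by rewrite divr_ge0// ltW.
  by rewrite ler_nat.
have [->|sN0] := eqVneq s 0; first by rewrite mulr0 subr0 S0// lerDl ltW.
have sgt0 : 0 < s by rewrite lt_neqAle eq_sym sN0.
pose h := s / n%:R; have h0 : 0 < h by rewrite divr_gt0.
have steps k : f x <= S (k%:R * h) f x + (c + q) * (k%:R * h).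
  elim: k => [|k IH]; first by rewrite mul0r mulr0 addr0 S0.
  have kh : 0 <= k%:R * h by rewrite mulr_ge0// ltW.
  rewrite -natr1 mulrDl mul1r SD//; last exact: ltW.
  apply: (le_trans IH).
  have : S (k%:R * h) f x <= S (k%:R * h) (S h f) x + (c + q) * h.
    apply: (markov_leD d_inv (Smc _ kh) (S_lin kh)) => //.
      by have [+ _ _ _] := Smc _ (ltW h0); exact.
    by move=> y; apply: fr; rewrite h0.
  lra.
have := steps n; rewrite /h mulrC divfK ?gt_eqF//.
have : q * s <= e.
  by rewrite /q mulrAC ler_pdivrMr// ler_wpM2l// ?ltW//; lra.
lra.
Qed.

End generator_lower_bound.

(** * The operators [Jop], their compositions along partitions, and the supremum over partitions *)

Section partition_operators.
Context {R : realType} {G : PreUniformZmodule.type} (d : G -> G -> R).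
Hypothesis d_inv : invariant_metric d.
Context {L : Type} (S : L -> R -> (G -> R) -> (G -> R)).
Hypotheses (L_neq0 : inhabited L)
  (S_markov : forall l t, 0 <= t -> markovian_convolution (S l t))
  (S_lin : forall l t, 0 <= t -> linear_on_BUC (S l t)).
Implicit Types f g h : G -> R.

Lemma has_ubound_Jop t f x : 0 <= t -> BUC f ->
  has_ubound (range (fun l => S l t f x)).
Proof.
move=> t0 bf; have /(BUCP d_inv)[[M fM] _] := bf.
exists M => _ [l _ <-].
apply: (markov_le_cst d_inv (S_markov l t0) (S_lin l t0)) => // y.
exact: le_trans (ler_norm _) (fM y).
Qed.

Lemma Jop_le_cst t f (M : R) x : 0 <= t -> BUC f ->
  (forall y, f y <= M) -> Jop S t f x <= M.
Proof.
move=> t0 bf fM; have [l0] := L_neq0; apply: ge_sup; first by eexists; exists l0.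
by move=> _ [l _ <-]; exact: (markov_le_cst d_inv (S_markov l t0) (S_lin l t0)).
Qed.

(** All the [S l t f] share the modulus of continuity of [f], so their supremum over [l] has it
    too. *)
Lemma BUC_Jop t f : 0 <= t -> BUC f -> BUC (Jop S t f).
Proof.
move=> t0 bf; have /(BUCP d_inv)[[M fM] fu] := bf; have [l0] := L_neq0.
have [_ dC _ dD _] := d_inv.
apply/(BUCP d_inv); split.
  exists M => x; rewrite ler_norml; apply/andP; split.
    apply: (@le_trans _ _ (S l0 t f x)); last first.
      by apply: ub_le_sup; [exact: has_ubound_Jop|exists l0].
    apply: (markov_ge_cst d_inv (S_markov l0 t0) (S_lin l0 t0)) => // y.
    by have := fM y; rewrite ler_norml => /andP[].
  by apply: Jop_le_cst => // y; exact: le_trans (ler_norm _) (fM y).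
(* The supremum only preserves weak inequalities; halving [e] restores the strict one. *)
move=> e e0; have [|r r0 fr] := fu (e / 2); first by rewrite divr_gt0.
have Jle x y : d x y < r -> Jop S t f x <= Jop S t f y + e / 2.
  move=> xy; apply: sup_range_leD => //[|l]; first exact: has_ubound_Jop.
  apply: (markov_shift_le d_inv (S_markov l t0) (S_lin l t0)) => // z.
  have /fr : d (x + z) (y + z) < r by rewrite dD.
  by rewrite ltr_norml => /andP[_]; lra.
exists r => // x y xy; have := Jle _ _ xy; have := Jle y x; rewrite dC => /(_ xy).
by rewrite ltr_norml => ? ?; apply/andP; split; lra.
Qed.

Lemma BUC_Jsteps t0 ts f : path <=%R t0 ts -> BUC f -> BUC (Jsteps S t0 ts f).
Proof.
move=> + bf; elim: ts t0 => [//|t1 ts IH] t0 /= /andP[t01 p].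
by apply: BUC_Jop; [rewrite subr_ge0|exact: IH].
Qed.

Lemma Jsteps_le_cst t0 ts f (M : R) x : path <=%R t0 ts -> BUC f ->
  (forall y, f y <= M) -> Jsteps S t0 ts f x <= M.
Proof.
move=> + bf fM; elim: ts t0 x => [//|t1 ts IH] t0 x /= /andP[t01 p].
apply: Jop_le_cst; first by rewrite subr_ge0.
  exact: BUC_Jsteps.
by move=> y; exact: IH.
Qed.

(** Supplies what induction along [Jsteps] needs: nonnegative increments, with total at most [t]. As
    [0 \in p], the list is nonempty and the default of [head] never occurs. *)
Lemma sorted_partition t (p : {fset R}) : partitions t p ->
  let ts := sort <=%R (enum_fset p) in
  path <=%R (head 0 ts) (behead ts) /\
  last (head 0 ts) (behead ts) - head 0 ts <= t.
Proof.
move=> [p0 _ pt] ts; have mem s : (s \in ts) = (s \in p) by rewrite mem_sort.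
have : sorted <=%R ts by apply: sort_sorted; exact: le_total.
move: mem; case: ts => [|a ts] /= mem; first by have := mem 0; rewrite p0.
move=> srt; split => //.
have /pt/andP[a0 _] : a \in p by rewrite -mem mem_head.
have /pt/andP[_] : last a ts \in p by rewrite -mem mem_last.
lra.
Qed.

(** * Comparison with an error term [h] growing at rate at most [c] *)

Section supersolution.
Variables (h : G -> R) (c : R).
Hypotheses (bh : BUC h) (c_ge0 : 0 <= c)
  (h_super : forall l s x, 0 <= s -> S l s h x <= h x + c * s).

(** In the induction, linearity splits [S l] of the inner bound into a [g] part, absorbed by [Jop],
    and [S l h], which returns [h] plus the cost of this step. The costs telescope. *)
Lemma Jsteps_leD t0 ts f g x : path <=%R t0 ts -> BUC f -> BUC g ->
  (forall y, f y <= g y + h y) ->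
  Jsteps S t0 ts f x <= Jsteps S t0 ts g x + (h x + c * (last t0 ts - t0)).
Proof.
move=> + bf bg fg; elim: ts t0 x => [|t1 ts IH] t0 x /=.
  by move=> _; rewrite subrr mulr0 addr0.
move=> /andP[t01 p]; have t10 : 0 <= t1 - t0 by rewrite subr_ge0.
have bJg := BUC_Jsteps p bg.
apply: sup_range_leD => //[|l]; first exact: has_ubound_Jop.
(* The cost of the remaining steps is constant in space, so [S l] leaves it unchanged. *)
pose a := c * (last t1 ts - t1).
have : S l (t1 - t0) (Jsteps S t1 ts f) x <=
    S l (t1 - t0) (fun y => 1 * Jsteps S t1 ts g y + h y) x + a.
  apply: (markov_leD d_inv (S_markov l t10) (S_lin l t10)).
  - exact: BUC_Jsteps.
  - exact: (BUC_linear d_inv).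
  - by move=> y; rewrite mul1r -addrA; exact: IH.
rewrite (S_lin l t10)// mul1r; have := h_super l x t10; rewrite /a; lra.
Qed.

Lemma Jpart_leD t p f g x : partitions t p -> BUC f -> BUC g ->
  (forall y, f y <= g y + h y) ->
  Jpart S p f x <= Jpart S p g x + (h x + c * t).
Proof.
move=> /sorted_partition[srt lt] bf bg fg.
apply: (le_trans (Jsteps_leD x srt bf bg fg)).
by rewrite !lerD2l ler_wpM2l.
Qed.

(** The error in [Jpart_leD] is the same for all partitions of [[0, t]], hence survives their
    supremum. *)
Lemma assoc_semigroup_leD t f g x : 0 <= t -> BUC f -> BUC g ->
  (forall y, f y <= g y + h y) ->
  assoc_semigroup S t f x <= assoc_semigroup S t g x + (h x + c * t).
Proof.
move=> t0 bf bg fg; apply: ge_sup.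
  (* The trivial partition shows that the supremum is over a nonempty set; for [t = 0] it is
     [{0}]. *)
  exists (Jpart S [fset 0; t]%fset f x), [fset 0; t]%fset => //.
  split; rewrite ?in_fset2 ?eqxx ?orbT//.
  by move=> s; rewrite in_fset2 => /orP[]/eqP->; rewrite lexx t0.
move=> _ [p pt <-]; apply: (le_trans (Jpart_leD x pt bf bg fg)).
rewrite lerD2r; apply: ub_le_sup; last by exists p.
have /(BUCP d_inv)[[M gM] _] := bg.
exists M => _ [p' /sorted_partition[srt _] <-]; apply: Jsteps_le_cst => // y.
exact: le_trans (ler_norm _) (gM y).
Qed.

End supersolution.

(** Monotonicity is the comparison with [h = 0] and [c = 0]. *)
Lemma assoc_semigroup_le t f g x : 0 <= t -> BUC f -> BUC g ->
  (forall y, f y <= g y) -> assoc_semigroup S t f x <= assoc_semigroup S t g x.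
Proof.
move=> t0 bf bg fg.
have := @assoc_semigroup_leD (cst 0) 0 (BUC_cst d_inv 0) (lexx 0) _ t f g x.
rewrite mul0r !addr0; apply => // [l s y s0|y]; last by rewrite addr0.
by rewrite (markov_cst (S_markov l s0)) mul0r addr0.
Qed.

End partition_operators.

(** * The error term built from [phi], and continuity from above *)

Lemma C0_dini (R : realType) (G : PreUniformZmodule.type) (phi : G -> R)
    (u : nat -> G -> R) (M e : R) :
  C0 phi -> (forall x, 0 <= phi x <= 1) ->
  (forall n, continuous (u n)) -> decreases_to u (fun=> 0) ->
  (forall n x, 0 <= u n x <= M) -> 0 < M -> 0 < e ->
  \forall n \near \oo, forall x, u n x * phi x <= e.
Proof.
move=> phi0 phi01 uc udec uM M0 e0.
have [|psi [_ psiK] phipsi] := phi0 (e / M); first by rewrite divr_gt0.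
have := dini psiK uc udec e0; apply: filterS => n uK x.
have /andP[u0 uleM] := uM n x; have /andP[p0 p1] := phi01 x.
(* On the compact support of [psi] Dini's theorem makes [u n] small; off it [phi < e / M] while
   [u n <= M]. *)
have [Kx|nKx] := pselect (closure [set x | psi x != 0] x).
  have := uK x Kx => ue; apply: (@le_trans _ _ (u n x)); last exact: ltW.
  by rewrite -[leRHS]mulr1 ler_wpM2l.
have psix : psi x = 0.
  by apply/eqP; apply: contrapT => /negP px; apply: nKx; exact: subset_closure.
have := supnorm_lt x phipsi; rewrite /= psix subr0 ger0_norm// => phix.
apply: (@le_trans _ _ (M * (e / M))); first by rewrite ler_pM// ltW.
by rewrite mulrC divfK// gt_eqF.
Qed.

(** The lower bound [T s phi >= phi - c s] becomes an upper bound after multiplication by [- M];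
    [T s] fixes constants and commutes with translations. *)
Lemma translate_supersolution (R : realType) (G : PreUniformZmodule.type)
    (d : G -> G -> R) (T : R -> (G -> R) -> (G -> R)) (phi g : G -> R)
    (M a c s : R) (x0 x : G) :
  invariant_metric d -> markovian_convolution_semigroup T ->
  (forall t, 0 <= t -> linear_on_BUC (T t)) ->
  BUC phi -> generator_at T phi g -> (forall y, - c <= g y) ->
  0 <= M -> 0 <= s ->
  T s (fun y => - M * Defs.shift phi (- x0) y + cst a y) x <=
  - M * Defs.shift phi (- x0) x + cst a x + M * c * s.
Proof.
move=> d_inv Tm Tl bphi phig gc M0 s0.
have [/(_ _ s0) Tms _ _ _] := Tm.
rewrite Tl//; last 2 first.
- exact: (BUC_shift d_inv).
- exact: (BUC_cst d_inv).
rewrite (markov_cst Tms) (markov_shift d_inv)//.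
have := semigroup_ge d_inv Tm Tl (- x0 + x) bphi phig gc s0.
by move=> /(ler_wpM2l M0); rewrite /Defs.shift /cst mulrBr mulrA mulNr; lra.
Qed.

Lemma assoc_semigroup_continuous_from_above (R : realType)
    (G : PreUniformZmodule.type) (d : G -> G -> R) (L : Type)
    (DA : L -> set (G -> R)) (A : L -> (G -> R) -> (G -> R))
    (S : L -> R -> (G -> R) -> (G -> R)) (t : R) :
  invariant_metric d -> inhabited L ->
  (forall l, [/\ markovian_convolution_semigroup (S l),
                 forall t, 0 <= t -> linear_on_BUC (S l t) &
                 is_generator (S l) (DA l) (A l)]) ->
  (forall e : R, 0 < e -> exists phi : G -> R,
     [/\ forall l, DA l phi /\ C0 phi,
         forall x, 0 <= phi x <= 1,
         phi 0 = 1 &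
         (ereal_sup (range (fun l => supnorm (A l phi))) <= e%:E)%E]) ->
  0 <= t -> continuous_from_above (assoc_semigroup S t).
Proof.
move=> d_inv L_neq0 A1 A3 t0 u f bu bf [und uf].
have S_markov l s : 0 <= s -> markovian_convolution (S l s).
  by move=> s0; have [[+ _ _ _] _ _] := A1 l; exact.
have S_lin l s : 0 <= s -> linear_on_BUC (S l s).
  by move=> s0; have [_ + _] := A1 l; exact.
have fu n y : f y <= u n y.
  rewrite -(cvg_lim _ (uf y))//; apply: nonincreasing_cvgn_ge => //.
  by apply/cvg_ex; exists (f y).
split=> x0.
  by move=> m n mn; apply: (assoc_semigroup_le d_inv) => // y; exact: und.
apply/cvgrPdist_le => e e0.
(* [M] bounds the first gap, hence by monotonicity every gap [u n - f]; it is made positive to be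
   divided by. *)
have [M M0 uM] : exists2 M, 0 < M & forall y, u 0%N y - f y <= M.
  have /(BUCP d_inv)[[N uN] _] := BUC_linear d_inv (-1) bf (bu 0%N).
  exists (`|N| + 1) => [|y]; first by rewrite ltr_wpDl.
  have := uN y; rewrite ler_norml => /andP[_]; have := ler_norm N; lra.
have t1 : 0 < t + 1 by rewrite ltr_wpDl.
(* Chosen so that the total time cost [M * q * t] is at most [e / 2]; [t + 1] allows [t = 0]. *)
pose q := e / 2 / M / (t + 1); have q0 : 0 < q by rewrite !divr_gt0.
have [phi [phiD phi01 phi0 Aphi]] := A3 q q0.
have [l0] := L_neq0; have [phiD0 phiC0] := phiD l0.
have bphi : BUC phi by have [_ _ [/(_ phi)[/(_ phiD0)[]]]] := A1 l0.
pose psi := Defs.shift phi (- x0).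
(* Translating the gaps by [x0] lets [C0_dini] be applied to [phi] itself rather than to its
   translate [psi]. *)
have ud : decreases_to (fun n y => u n (x0 + y) - f (x0 + y)) (fun=> 0).
  split=> y; first by move=> m n mn; rewrite lerD2r; exact: und.
  by rewrite -(subrr (f (x0 + y))); apply: cvgB => //; exact: cvg_cst.
have uc n : continuous (fun y => u n (x0 + y) - f (x0 + y)).
  have cont (g : G -> R) : BUC g -> continuous (Defs.shift g x0).
    by move=> bg; exact: (BUC_continuous (BUC_shift d_inv x0 bg)).
  by move=> y; apply: cvgB; [exact: (cont _ (bu n))|exact: (cont _ bf)].
have ub n y : 0 <= u n y - f y <= M.
  by rewrite subr_ge0 fu /=; apply: (le_trans _ (uM y)); rewrite lerD2r und.
have e20 : 0 < e / 2 by rewrite divr_gt0.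
near=> n.
have un_small y : (u n (x0 + y) - f (x0 + y)) * phi y <= e / 2.
  move: y; near: n; apply: (C0_dini phiC0 phi01 uc ud) M0 e20 => n y.
  exact: ub.
rewrite distrC ger0_norm ?subr_ge0; last exact: (assoc_semigroup_le d_inv).
rewrite lerBlDl.
pose h := fun y => - M * psi y + cst (e / 2 + M) y.
have bh : BUC h.
  by apply: (BUC_linear d_inv); [exact: (BUC_shift d_inv)|exact: (BUC_cst d_inv)].
have hs l s y : 0 <= s -> S l s h y <= h y + M * q * s.
  move=> s0; have [Slm Sll [_ /(_ phi (phiD l).1)[_ gen]]] := A1 l.
  apply: (translate_supersolution _ _ _ d_inv Slm Sll bphi gen) => //; last exact: ltW.
  move=> z; have : (`|A l phi z|%:E <= q%:E)%E.
    apply: le_trans Aphi; apply: (le_trans (supnorm_ge _ z)).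
    by apply: ereal_sup_ubound; exists l.
  by rewrite lee_fin ler_norml => /andP[].
(* Split the gap as [(u n - f) * psi + (u n - f) * (1 - psi)]: the first term is at most [e / 2],
   the second at most [M * (1 - psi)]. *)
have fh y : u n y <= f y + h y.
  have : (u n y - f y) * psi y <= e / 2.
    have -> : u n y - f y = u n (x0 + (- x0 + y)) - f (x0 + (- x0 + y)).
      by rewrite addNKr.
    exact: un_small.
  have /andP[_] := phi01 (- x0 + y); have := ub n y; rewrite /h /psi /Defs.shift /=.
  nra.
apply: (le_trans (assoc_semigroup_leD d_inv L_neq0 S_markov S_lin bh _ hs x0 t0
  (bu n) bf fh)).
  by rewrite mulr_ge0// ltW.
(* As [phi 0 = 1], the value of [h] at [x0] is [e / 2]; the time cost takes the other half of
   [e]. *)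
rewrite lerD2l /h /psi /Defs.shift addNr phi0 /= mulr1.
have : M * q * t <= e / 2.
  have -> : M * q * t = (e / 2) * t / (t + 1) by rewrite /q; field; rewrite !gt_eqF.
  rewrite ler_pdivrMr// ler_wpM2l// ?ltW//; lra.
lra.
Unshelve. all: by end_near. Qed.

Theorem proposition2p8 (R : realType) (G : PreUniformZmodule.type)
  (dist : G -> G -> R)
  (L : Type)
  (DA : L -> set (G -> R)) (A : L -> (G -> R) -> (G -> R))
  (S : L -> R -> (G -> R) -> (G -> R))
  (dist_metric : invariant_metric dist)
  (G_sep : separable G) (G_compl : complete G)
  (L_neq0 : inhabited L)
  (A1 : forall l, [/\ markovian_convolution_semigroup (S l),
                      forall t, 0 <= t -> linear_on_BUC (S l t) &
                      is_generator (S l) (DA l) (A l)])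
  (A2 : dense_in_BUC (common_domain DA A))
  (A3 : forall e : R, 0 < e -> exists phi : G -> R,
     [/\ forall l, DA l phi /\ C0 phi,
         forall x, 0 <= phi x <= 1,
         phi 0 = 1 &
         (ereal_sup (range (fun l => supnorm (A l phi))) <= e%:E)%E]) :
  (forall t, 0 <= t -> continuous_from_above (assoc_semigroup S t)) /\
  (forall (disp : measure_display) (Omega : measurableType disp)
     (E : (Omega -> R) -> R) (X : R -> Omega -> G),
     sublinear_expectation_space E -> levy_process E X ->
     (forall t f x, 0 <= t -> BUC f ->
        assoc_semigroup S t f x = E (fun w => f (x + X t w))) ->
     forall t, 0 <= t ->
       continuous_from_above (fun f x => E (fun w => f (x + X t w)))).
Proof.
have S_markov l t : 0 <= t -> markovian_convolution (S l t).
  by move=> t0; have [[+ _ _ _] _ _] := A1 l; exact.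
have S_lin l t : 0 <= t -> linear_on_BUC (S l t).
  by move=> t0; have [_ + _] := A1 l; exact.
have first_half t : 0 <= t -> continuous_from_above (assoc_semigroup S t).
  move=> t0; exact: (assoc_semigroup_continuous_from_above dist_metric L_neq0
    A1 A3).
split=> // disp Omega E X _ _ EX t t0 u f bu bf /(first_half t t0 u f bu bf).
(* The representation is given on BUC only, so it is applied to [f] and to each [u n] separately. *)
have toE g : BUC g -> assoc_semigroup S t g = fun x => E (fun w => g (x + X t w)).
  by move=> bg; apply/funext => x; exact: EX.
rewrite -(toE f bf); congr decreases_to; apply/funext => n; exact: toE.
Qed.
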